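(* Let $\{Y_i\}_{i\ge 1}$ be a sequence of $\mathbb{R}_+^J$-valued random vectors. Suppose that each $Y_i$ admits two representations $$Y_i^\top = W_i^\top H=\widetilde W_i^\top \widetilde H ,$$ where $H$ and $\widetilde H$ are (fixed) $K\times J$ matrices with non-negative entries, $\{W_i\}_{i\ge 1}$ and $\{\widetilde W_i\}_{i\ge 1}$ are $\mathbb{R}_+^K$-valued processes each of which satisfies Assumption E (ergodicity and stationarity) and Assumption S (probabilistic separability), and at least one of $H$, $\widetilde H$ has full row rank. Let $\Phi$ be the source attribution matrix derived from the marginal distribution $\mathbb{P}_W$ of $W_i$ and $H$, and let $\widetilde\Phi$ be the source attribution matrix derived from the marginal distribution $\mathbb{P}_{\widetilde W}$ of $\widetilde W_i$ and $\widetilde H$. Then $\widetilde\Phi=\Phi$ up to a permutation of rows.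
   Context: $\mathbb{R}_+=[0,\infty)$. All random objects live on a common probability space. Assumption E (ergodicity and stationarity) for a process $\{W_i\}_{i\ge1}$: it is a (strictly) stationary ergodic process on $\mathbb{R}_+^K$ with marginal distribution $\mathbb{P}_W$ having support $\mathbb{S}_W\subseteq\mathbb{R}_+^K$ (a point $a$ belongs to $\mathbb S_W$ if and only if every open ball around $a$ has positive $\mathbb{P}_W$-probability), and with finite mean $\mu=\mathbb{E}(W_i)\in\mathbb{R}_+^K$. No independence across $i$ is assumed. Assumption S (probabilistic separability) for $\{W_i\}_{i\ge1}$: there exist constants $c_k>0$ such that $c_k e_k\in\mathbb{S}_W$ for every $k=1,\dots,K$, where $e_k$ is the $k$th canonical basis vector of $\mathbb{R}^K$. (The constants may differ between $\{W_i\}$ and $\{\widetilde W_i\}$.) Source attribution matrix: given $\mathbb{P}_W$ with mean $\mu=(\mu_1,\dots,\mu_K)$ and a non-negative $K\times J$ matrix $H=(H_{kj})$, it is the $K\times J$ matrix $\Phi=(\phi_{kj})$ with $$\phi_{kj}=\frac{\mu_kH_{kj}}{\sum_{\ell=1}^K\mu_\ell H_{\ell j}} .$$ This definition presupposes that each denominator is positive (i.e. no pollutant column is identically zero). *)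

(* Defs.v *)
From mathcomp Require Import all_boot all_order all_algebra all_fingroup.
From mathcomp Require Import all_classical all_reals all_analysis.

Set Implicit Arguments.
Unset Strict Implicit.
Unset Printing Implicit Defensive.

Import Order.TTheory GRing.Theory Num.Theory.
Import numFieldNormedType.Exports.

Local Open Scope classical_set_scope.
Local Open Scope ring_scope.

(* Row vectors with their Borel sigma-algebra. *)
Definition borel_rV (R : realType) (n : nat) :=
  g_sigma_algebraType (@open 'rV[R]_n).

Definition nonneg_rV (R : realType) (n : nat) (v : 'rV[R]_n) : Prop :=
  forall j, 0 <= v 0 j.

Definition nonneg_mx (R : realType) (m n : nat) (A : 'M[R]_(m, n)) : Prop :=
  forall i j, 0 <= A i j.

(* [ball] is the ball of the max norm; it gives the same support as the
   Euclidean ball. *)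
Definition support (R : realType) (n : nat) (Q : probability (borel_rV R n) R) :
    set 'rV[R]_n :=
  [set a | forall e : R, 0 < e -> (0 < Q (ball a e))%E].

Definition finite_mean (R : realType) (n : nat)
    (Q : probability (borel_rV R n) R) : Prop :=
  forall k, Q.-integrable setT (fun v : 'rV[R]_n => (v 0 k)%:E).

(* Meaningful under [finite_mean Q]; otherwise [fine] may return 0. *)
Definition mean (R : realType) (n : nat) (Q : probability (borel_rV R n) R) :
    'rV[R]_n :=
  \row_k fine 'E_Q[fun v : 'rV[R]_n => v 0 k].

(* Product sigma-algebra on the space of trajectories. *)
Definition path_measurable (R : realType) (n : nat) :
    set (set (nat -> borel_rV R n)) :=
  <<s \bigcup_i preimage_set_system setT (fun w => w i) measurable >>.

Section process.
Context d (T : measurableType d) (R : realType) (P : probability T R) (n : nat).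
(* Time starts at 0: [W i] is the vector of index i + 1. *)
Implicit Type W : nat -> {RV P >-> borel_rV R n}.

(* Under stationarity all the W i have the same law. *)
Definition marginal W : probability (borel_rV R n) R := distribution P (W 0%N).

Definition stationary W : Prop :=
  forall (h : nat) (A : set (nat -> borel_rV R n)), path_measurable A ->
    P [set x | A (fun i => W (i + h)%N x)] = P [set x | A (fun i => W i x)].

Definition ergodic W : Prop :=
  forall A : set (nat -> borel_rV R n), path_measurable A ->
    (fun (w : nat -> borel_rV R n) i => w i.+1) @^-1` A = A ->
    P [set x | A (fun i => W i x)] = 0%E \/
    P [set x | A (fun i => W i x)] = 1%E.

Record ergodic_stationary W : Prop := ErgodicStationary {
  ES_nonneg : forall i x, nonneg_rV (W i x);
  ES_stationary : stationary W;
  ES_ergodic : ergodic W;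
  ES_finite_mean : finite_mean (marginal W) }.

(* [delta_mx 0 k] is the k-th canonical basis row vector. *)
Definition prob_separable W : Prop :=
  forall k : 'I_n, exists2 c : R, 0 < c &
    support (marginal W) (c *: delta_mx 0 k).

End process.

Definition attribution_denom (R : realType) (K J : nat)
    (Q : probability (borel_rV R K) R) (H : 'M[R]_(K, J)) (j : 'I_J) : R :=
  \sum_(l < K) mean Q 0 l * H l j.

(* Used only where every [attribution_denom Q H j] is positive. *)
Definition source_attribution (R : realType) (K J : nat)
    (Q : probability (borel_rV R K) R) (H : 'M[R]_(K, J)) : 'M[R]_(K, J) :=
  \matrix_(k, j) (mean Q 0 k * H k j / attribution_denom Q H j).

(* Main.v *)
Require Import Defs.
From mathcomp Require Import all_boot all_order all_algebra all_fingroup.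
From mathcomp Require Import all_classical all_reals all_analysis measurable_realfun.

(** Only the law of the first observation matters. Almost surely
    [W H = Wt Ht], and every row of [H] is, up to a positive factor, the image
    under [H] of a point of the support of [W]; since a closed condition that
    holds almost surely holds on the support, every row of [H] lies in the row
    space of [Ht] ([row_space_separable]), and conversely. The two row spaces
    therefore coincide; as one of the matrices has full row rank, so has the
    other, and [H = A Ht] with [A] invertible.

    Cancelling [Ht] gives [W A = Wt] almost surely. As [Wt] is nonnegative, the
    same support argument, applied to the closed condition that a coordinate of
    [w A] be nonnegative, shows that [A] has nonnegative entries
    ([nonneg_separable]); by symmetry so has its inverse. A nonnegative matrix
    with a nonnegative inverse is monomial ([nonneg_inverse_monomial]): its
    columns are positive multiples of distinct basis vectors.

    Taking expectations in [W A = Wt] gives [mut = mu A] ([mean_mulmx]), hence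
    [mut Ht = mu A Ht = mu H]: both attribution matrices have the same
    denominators. Reading [mut = mu A] and [H = A Ht] along the single nonzero
    entry in column [k] of [A], say in row [s k], its scale factor moves
    from [mu] to [H], so that [mut_k Ht_kj = mu_(s k) H_(s k)j]: the numerators
    agree up to the permutation [s]. *)

Import Order.TTheory GRing.Theory Num.Theory.
Import numFieldNormedType.Exports.

Local Open Scope classical_set_scope.
Local Open Scope ring_scope.

Lemma continuous_mulmx_coord (R : realType) (m n : nat) (M : 'M[R]_(m, n))
    (j : 'I_n) :
  continuous (fun v : 'rV[R]_m => (v *m M) 0 j).
Proof.
rewrite (_ : (fun v => _) =
  (fun v : 'rV[R]_m => \sum_(i <- index_enum 'I_m | true) v 0 i * M i j)); last first.
  by apply/funext => v; rewrite mxE.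
apply: continuous_big => [x|i _ v].
  exact: add_continuous.
by apply: continuousM; [exact: coord_continuous|exact: cst_continuous].
Qed.

Section law.
Context {d} {T : measurableType d} {R : realType} {P : probability T R}.

(** A point outside [C] has a ball around it inside the complement of [C], and
    that ball is null. *)
Lemma support_sub_closed (n : nat) (X : {RV P >-> borel_rV R n})
    (C : set 'rV[R]_n) :
    closed C -> {ae P, forall x, C (X x)} ->
  Defs.support (distribution P X) `<=` C.
Proof.
move=> clC aeC a supp_a; apply: contrapT => nCa.
have /nbhs_ballP[e e0 ballC] : nbhs a (~` C).
  by apply: open_nbhs_nbhs; split => //; exact: closed_openC.
have mball : measurable (ball a e : set (borel_rV R n)).
  by apply: sub_sigma_algebra; exact: ball_open.
have [N [mN PN0 subN]] := aeC.
have := supp_a e e0; rewrite /= lt_neqAle => /andP[/eqP + _]; apply.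
apply/esym/(subset_measure0 _ mN _ PN0).
  by rewrite -[X in measurable X]setTI; exact: measurable_funPT.
by move=> x Xx; apply: subN; exact: ballC.
Qed.

Lemma integrable_distribution (d' : measure_display) (T' : measurableType d')
    (X : {RV P >-> T'}) (f : T' -> \bar R) :
  (distribution P X).-integrable setT f -> P.-integrable setT (f \o X).
Proof.
move=> /integrableP[mf intf]; apply/integrableP; split.
  by apply: measurableT_comp => //; exact: measurable_funPT.
by move: intf; rewrite ge0_integral_distribution//; exact: measurableT_comp.
Qed.

Lemma mean_distribution (n : nat) (X : {RV P >-> borel_rV R n}) :
    finite_mean (distribution P X) ->
  forall k, P.-integrable setT (fun x => ((X x : 'rV[R]_n) 0 k)%:E) /\
    (mean (distribution P X) 0 k)%:E =
      (\int[P]_x ((X x : 'rV[R]_n) 0 k)%:E)%E.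
Proof.
move=> fm k; have iX := integrable_distribution _ _ _ _ (fm k).
split=> //; rewrite mxE unlock.
rewrite (integral_distribution (measurable_int _ (fm k)) iX) fineK //.
exact: integrable_fin_num iX.
Qed.

Lemma mean_mulmx (m n : nat) (X : {RV P >-> borel_rV R m})
    (Z : {RV P >-> borel_rV R n}) (A : 'M[R]_(m, n)) :
    finite_mean (distribution P X) -> finite_mean (distribution P Z) ->
    {ae P, forall x, (X x : 'rV[R]_m) *m A = (Z x : 'rV[R]_n)} ->
  mean (distribution P Z) = mean (distribution P X) *m A.
Proof.
move=> fX fZ XAZ; apply/rowP => k.
have [iZ eZ] := mean_distribution _ _ fZ k.
have iXA i : P.-integrable setT (fun x => ((A i k)%:E * ((X x : 'rV[R]_m) 0 i)%:E)%E).
  by apply: integrableZl => //; have [] := mean_distribution _ _ fX i.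
apply: EFin_inj; rewrite eZ mxE -sumEFin.
transitivity (\int[P]_x (\sum_i (A i k)%:E * ((X x : 'rV[R]_m) 0 i)%:E))%E.
  apply: ae_eq_integral => //; first exact: measurable_int iZ.
    by apply: measurable_int; apply: integrable_sum.
  apply: filterS XAZ => x <- _.
  by rewrite mxE -sumEFin; apply: eq_bigr => i _; rewrite mulrC.
rewrite integral_sum //; apply: eq_bigr => i _.
have [iX eX] := mean_distribution _ _ fX i.
by rewrite integralZl // -eX -EFinM mulrC.
Qed.

Section separable.
Context (K J : nat) (W Wt : nat -> {RV P >-> borel_rV R K}).
Context (W_sep : prob_separable W).

(** Testing the row [k] of [H] against the support point [c e_k]: the image of
    that point is [c] times this row, and lying in the row space of [Ht] is the
    closed condition of being annihilated by [cokermx Ht]. *)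
Lemma row_space_separable (H Ht : 'M[R]_(K, J)) :
    {ae P, forall x, (W 0%N x : 'rV[R]_K) *m H = (Wt 0%N x : 'rV[R]_K) *m Ht} ->
  (H <= Ht)%MS.
Proof.
move=> WH; rewrite submxE; apply/eqP/matrixP => k j; rewrite [RHS]mxE.
set N := H *m _; have [c c0 supp_c] := W_sep k.
have clC : closed [set v : 'rV[R]_K | (v *m N) 0 j = 0].
  apply: (preimage_closed (f := fun v : 'rV[R]_K => (v *m N) 0 j)
                          (D := [set x | x = 0])); last exact: closed_eq.
  by move=> v _; exact: continuous_mulmx_coord.
have /(support_sub_closed _ _ _ clC)/(_ _ supp_c)/= :
    {ae P, forall x, [set v : 'rV[R]_K | (v *m N) 0 j = 0] (W 0%N x)}.
  by apply: filterS WH => x /= WHx; rewrite mulmxA WHx -mulmxA mulmx_coker mulmx0 mxE.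
rewrite -scalemxAl -rowE !mxE => /eqP.
by rewrite mulf_eq0 gt_eqF//= => /eqP.
Qed.

(** The row [k] of [A] is, up to a positive factor, the image of a support
    point of [W] under a map which almost surely takes values in the closed
    nonnegative orthant. *)
Lemma nonneg_separable (A : 'M[R]_K) :
    (forall x, nonneg_rV (Wt 0%N x)) ->
    {ae P, forall x, (W 0%N x : 'rV[R]_K) *m A = (Wt 0%N x : 'rV[R]_K)} ->
  nonneg_mx A.
Proof.
move=> Wt0 WA k j; have [c c0 supp_c] := W_sep k.
have clC : closed [set v : 'rV[R]_K | 0 <= (v *m A) 0 j].
  apply: (preimage_closed (f := fun v : 'rV[R]_K => (v *m A) 0 j)
                          (D := [set x | 0 <= x])); last exact: closed_ge.
  by move=> v _; exact: continuous_mulmx_coord.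
have /(support_sub_closed _ _ _ clC)/(_ _ supp_c)/= :
    {ae P, forall x, [set v : 'rV[R]_K | 0 <= (v *m A) 0 j] (W 0%N x)}.
  by apply: filterS WA => x /= ->; exact: Wt0.
by rewrite -scalemxAl -rowE !mxE pmulr_rge0.
Qed.

End separable.
End law.

(** All terms of an off-diagonal entry of [A *m B = 1] or [B *m A = 1] are
    nonnegative with sum zero, so each of them vanishes. Thus a row [i] with
    [B k i * A i k > 0], which exists since [B *m A] has diagonal 1, carries
    the only nonzero entry of column [k] of [A], and that entry is the only
    nonzero one of its row. *)
Lemma nonneg_inverse_monomial (R : realFieldType) (n : nat) (A B : 'M[R]_n) :
    (forall i j, 0 <= A i j) -> (forall i j, 0 <= B i j) -> A *m B = 1%:M ->
  exists s : 'S_n, forall i k, i != s k -> A i k = 0.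
Proof.
move=> A0 B0 AB; have BA := mulmx1C AB.
have offdiag (M N : 'M[R]_n) i j k : (forall i j, 0 <= M i j) ->
    (forall i j, 0 <= N i j) -> M *m N = 1%:M -> i != k -> M i j * N j k = 0.
  move=> M0 N0 /matrixP/(_ i k); rewrite !mxE => + /negbTE ik.
  rewrite ik => /eqP; rewrite psumr_eq0; last by move=> l _; exact: mulr_ge0.
  by move=> /allP/(_ j (mem_index_enum _))/eqP.
have pivot k : exists i, (B k i != 0) && (A i k != 0).
  apply/existsP; apply: contraT; rewrite negb_exists => /forallP noi.
  have /eqP : (B *m A) k k = 0.
    rewrite mxE big1 // => i _; apply/eqP.
    by rewrite mulf_eq0 -(negbK (_ || _)) negb_or noi.
  by rewrite BA mxE eqxx oner_eq0.
pose f k := xchoose (pivot k).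
have Bf k : B k (f k) != 0 by case/andP: (xchooseP (pivot k)).
have Af k : A (f k) k != 0 by case/andP: (xchooseP (pivot k)).
have f_inj : injective f.
  move=> k k' fkk'; apply/eqP; apply: contraT => kk'.
  have /eqP := offdiag B A k (f k) k' B0 A0 BA kk'.
  by rewrite mulf_eq0 (negbTE (Bf k)) fkk' (negbTE (Af k')).
exists (perm f_inj) => i k; rewrite permE => ik.
have /eqP := offdiag A B i k (f k) A0 B0 AB ik.
by rewrite mulf_eq0 (negbTE (Bf k)) orbF => /eqP.
Qed.

Theorem theorem1 (R : realType) (d : measure_display) (T : measurableType d)
    (P : probability T R) (K J : nat)
    (Y : nat -> {RV P >-> borel_rV R J})
    (W Wt : nat -> {RV P >-> borel_rV R K})
    (H Ht : 'M[R]_(K, J))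
    (Y_nonneg : forall i x, nonneg_rV (Y i x))
    (YW : forall i, {ae P, forall x, (Y i x : 'rV[R]_J) = (W i x : 'rV[R]_K) *m H})
    (YWt : forall i, {ae P, forall x, (Y i x : 'rV[R]_J) = (Wt i x : 'rV[R]_K) *m Ht})
    (H_nonneg : nonneg_mx H) (Ht_nonneg : nonneg_mx Ht)
    (W_ES : ergodic_stationary W) (Wt_ES : ergodic_stationary Wt)
    (W_sep : prob_separable W) (Wt_sep : prob_separable Wt)
    (full_rank : row_free H \/ row_free Ht)
    (denom_pos : forall j, 0 < attribution_denom (marginal W) H j)
    (denomt_pos : forall j, 0 < attribution_denom (marginal Wt) Ht j) :
  exists s : 'S_K,
    source_attribution (marginal Wt) Ht =
      row_perm s (source_attribution (marginal W) H).
Proof.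
have WHWt : {ae P, forall x,
    (W 0%N x : 'rV[R]_K) *m H = (Wt 0%N x : 'rV[R]_K) *m Ht}.
  by apply: filterS2 (YW 0%N) (YWt 0%N) => x <- <-.
have WtHW : {ae P, forall x,
    (Wt 0%N x : 'rV[R]_K) *m Ht = (W 0%N x : 'rV[R]_K) *m H}.
  by apply: filterS WHWt => x ->.
have HHt : (H <= Ht)%MS := row_space_separable K J W Wt W_sep H Ht WHWt.
have HtH : (Ht <= H)%MS := row_space_separable K J Wt W Wt_sep Ht H WtHW.
have rankE : \rank H = \rank Ht by apply/eqP; rewrite eqn_leq !mxrankS.
have [freeH freeHt] : row_free H /\ row_free Ht.
  by move: full_rank; rewrite /row_free rankE => -[].
pose A := H *m pinvmx Ht; pose B := Ht *m pinvmx H.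
have AHt : A *m Ht = H by exact: mulmxKpV.
have AB : A *m B = 1%:M by rewrite mulmxA AHt mulmxVp.
have WA : {ae P, forall x, (W 0%N x : 'rV[R]_K) *m A = (Wt 0%N x : 'rV[R]_K)}.
  by apply: filterS WHWt => x WHx; rewrite mulmxA WHx mulmxKp.
have WtB : {ae P, forall x, (Wt 0%N x : 'rV[R]_K) *m B = (W 0%N x : 'rV[R]_K)}.
  by apply: filterS WtHW => x WHx; rewrite mulmxA WHx mulmxKp.
have A0 : nonneg_mx A.
  by apply: nonneg_separable W_sep _ _ WA => x; exact: ES_nonneg Wt_ES _ _.
have B0 : nonneg_mx B.
  by apply: nonneg_separable Wt_sep _ _ WtB => x; exact: ES_nonneg W_ES _ _.
have muA : mean (marginal Wt) = mean (marginal W) *m A.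
  by apply: mean_mulmx WA; [exact: ES_finite_mean W_ES|exact: ES_finite_mean Wt_ES].
have [s As] := nonneg_inverse_monomial _ _ A B A0 B0 AB.
exists s; apply/matrixP => k j; rewrite [LHS]mxE [RHS]mxE [RHS]mxE; congr (_ / _); last first.
  have denomE Q (M : 'M[R]_(K, J)) : attribution_denom Q M j = (mean Q *m M) 0 j.
    by rewrite mxE.
  by rewrite !denomE muA -mulmxA AHt.
have muE : mean (marginal Wt) 0 k = mean (marginal W) 0 (s k) * A (s k) k.
  rewrite muA mxE (bigD1 (s k)) //= big1 ?addr0 // => i ik.
  by rewrite As ?mulr0.
have HE : H (s k) j = A (s k) k * Ht k j.
  rewrite -AHt mxE (bigD1 k) //= big1 ?addr0 // => l lk.
  by rewrite As ?mul0r // (inj_eq perm_inj) eq_sym.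
by rewrite muE HE mulrA.
Qed.
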